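(* Let $K$ be a box-kite in the Sedenions (a set of six Assessors forming an octahedron under the Co-Assessor relation), let $\{(a,S),(b,T)\}$ be one of its three struts, and let $\varepsilon\in\{+1,-1\}$. Let $\Pi$ be the real plane spanned by $i_a+\varepsilon i_S$ and $i_b-\varepsilon i_T$. Then one can choose one diagonal ($i_c+i_U$ or $i_c-i_U$) from each of the four remaining Assessors $(c,U)$ of $K$ so that every element of $\Pi$ has product zero with every element of the 4-dimensional real subspace spanned by the four chosen diagonals. There are $6$ such (strut plane, 4-space) configurations in each box-kite, and hence $42$ such 4-dimensional spaces over the seven box-kites.
   Context: The Sedenions are the 16-dimensional real (non-associative, distributive) algebra with basis $1,i_1,\dots,i_{15}$, where $1$ is the unit, $i_n^2=-1$, $i_mi_n=-i_ni_m$ for $m\ne n$, and for each triplet $(a,b,c)$ in the following list $i_ai_b=i_c$, $i_bi_c=i_a$, $i_ci_a=i_b$. O-trips: (1,2,3),(1,4,5),(1,7,6),(2,4,6),(2,5,7),(3,4,7),(3,6,5). S-trips: (1,8,9),(1,11,10),(1,13,12),(1,14,15),(2,8,10),(2,9,11),(2,14,12),(2,15,13),(3,8,11),(3,10,9),(3,15,12),(3,13,14),(4,8,12),(4,9,13),(4,10,14),(4,11,15),(5,8,13),(5,12,9),(5,10,15),(5,14,11),(6,8,14),(6,15,9),(6,12,10),(6,11,13),(7,8,15),(7,9,14),(7,13,10),(7,12,11). Two (unordered) pairs $(A,B)$, $(C,D)$ of distinct indices in $\{1,\dots,15\}$ are Co-Assessors if $(i_A+s\,i_B)(i_C+t\,i_D)=0$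 for some signs $s,t\in\{+1,-1\}$. A pair $(A,B)$ is an Assessor if it is a Co-Assessor of some pair; Assessors are written $(a,S)$ with $a<S$. The Co-Assessor graph has the Assessors as vertices and an edge between any two Co-Assessors; its connected components are the seven box-kites, each having six vertices and forming an octahedron graph. A strut of a box-kite is a pair of its Assessors that are not Co-Assessors of each other (opposite vertices of the octahedron); each box-kite has three struts. *)

(* Defs.v *)
From HB Require Import structures.
From mathcomp Require Import all_boot all_order all_algebra.
From mathcomp Require Import boolp classical_sets functions cardinality reals.

Set Implicit Arguments.
Unset Strict Implicit.
Unset Printing Implicit Defensive.

Import GRing.Theory.
Local Open Scope ring_scope.

(* Coordinates with respect to the basis 1 = i_0, i_1, ..., i_15. *)
Notation sedenion R := ('rV[R]_16) (only parsing).

Definition O_trips : seq (nat * nat * nat) :=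
  [:: (1, 2, 3); (1, 4, 5); (1, 7, 6); (2, 4, 6); (2, 5, 7); (3, 4, 7);
      (3, 6, 5)]%N.

Definition S_trips : seq (nat * nat * nat) :=
  [:: (1, 8, 9); (1, 11, 10); (1, 13, 12); (1, 14, 15);
      (2, 8, 10); (2, 9, 11); (2, 14, 12); (2, 15, 13);
      (3, 8, 11); (3, 10, 9); (3, 15, 12); (3, 13, 14);
      (4, 8, 12); (4, 9, 13); (4, 10, 14); (4, 11, 15);
      (5, 8, 13); (5, 12, 9); (5, 10, 15); (5, 14, 11);
      (6, 8, 14); (6, 15, 9); (6, 12, 10); (6, 11, 13);
      (7, 8, 15); (7, 9, 14); (7, 13, 10); (7, 12, 11)]%N.

Definition trips := O_trips ++ S_trips.

Definition cyclic_trip (a b c : nat) : bool :=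
  [|| (a, b, c) \in trips, (b, c, a) \in trips | (c, a, b) \in trips].

Definition iunit (R : realType) (n : 'I_16) : sedenion R := delta_mx 0 n.

(* Every pair m != n of nonzero indices lies in exactly one triplet, so the sum
   in the last case has a single nonzero term: i_c or - i_c. *)
Definition iunit_mul (R : realType) (m n : 'I_16) : sedenion R :=
  if m == 0 then iunit R n
  else if n == 0 then iunit R m
  else if m == n then - iunit R 0
  else \sum_(c < 16)
    ((cyclic_trip m n c)%:R - (cyclic_trip n m c)%:R) *: iunit R c.

Definition smul (R : realType) (x y : sedenion R) : sedenion R :=
  \sum_(m < 16) \sum_(n < 16) (x 0 m * y 0 n) *: iunit_mul R m n.

(* An unordered pair of distinct indices in {1, ..., 15} is represented by the
   ordered pair p with 0 < p.1 < p.2. *)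
Definition index_pair := ('I_16 * 'I_16)%type.

Definition wf_pair (p : index_pair) : bool := (0 < p.1 < p.2)%N.

(* Signs are booleans: false stands for +1 and true for -1. *)
Definition diagonal (R : realType) (s : bool) (p : index_pair) : sedenion R :=
  iunit R p.1 + (-1) ^+ s *: iunit R p.2.

Definition coassessors (R : realType) : rel index_pair := fun p q =>
  [&& wf_pair p, wf_pair q &
      [exists s : bool, exists t : bool,
         smul (diagonal R s p) (diagonal R t q) == 0]].

Definition assessors (R : realType) : {set index_pair} :=
  [set p | [exists q, coassessors R p q]]%SET.

Definition boxkites (R : realType) : {set {set index_pair}} :=
  equivalence_partition (connect (coassessors R)) (assessors R).

(* The octahedron graph K_{2,2,2}: six vertices, each adjacent to all the
   others but exactly one. *)
Definition octahedron (e : rel index_pair) (K : {set index_pair}) : bool :=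
  (#|K| == 6)%N &&
  [forall p in K, #|[set q in K | (q != p) && ~~ e p q]%SET| == 1%N].

Definition is_strut (R : realType) (K : {set index_pair}) (p q : index_pair) :
    bool :=
  [&& p \in K, q \in K, p != q & ~~ coassessors R p q].

Definition struts (R : realType) (K : {set index_pair}) :
    {set {set index_pair}} :=
  [set [set pq.1; pq.2] | pq in [set pq | is_strut R K pq.1 pq.2]]%SET.

Definition strut_plane (R : realType) (p q : index_pair) (eps : bool) :
    {vspace sedenion R} :=
  <<[:: diagonal R eps p; diagonal R (~~ eps) q]>>%VS.

(* Only the values of sg on the four Assessors of K other than p, q matter. *)
Definition diagonal_space (R : realType) (K : {set index_pair})
    (p q : index_pair) (sg : index_pair -> bool) : {vspace sedenion R} :=
  <<[seq diagonal R (sg r) r | r <- enum (K :\: [set p; q])%SET]>>%VS.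

Definition zero_product (R : realType) (U V : {vspace sedenion R}) : Prop :=
  forall x y, x \in U -> y \in V -> smul x y = 0 /\ smul y x = 0.

Definition configurations (R : realType) (K : {set index_pair}) :
    set ({vspace sedenion R} * {vspace sedenion R}) :=
  fun PV => exists (p q : index_pair) (eps : bool) (sg : index_pair -> bool),
    [/\ is_strut R K p q,
        PV = (strut_plane R p q eps, diagonal_space R K p q sg) &
        zero_product PV.1 PV.2].
Arguments configurations : clear implicits.

Definition configuration_spaces (R : realType) : set {vspace sedenion R} :=
  fun V => exists K P, K \in boxkites R /\ configurations R K (P, V).
Arguments configuration_spaces : clear implicits.

(* Main.v *)
(**
  Since i_m i_n = +- i_{m xor n}, a product (i_A + s i_B)(i_C + t i_D) has four
  terms which vanish only by cancelling in two pairs; so the Co-Assessor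
  relation is a finite table.  The Assessors turn out to be the pairs
  (a, 8 + b) with a, b distinct in {1, ..., 7}; the box-kite of (a, S) is
  determined by the index of i_a i_S, and the strut opposite of (a, 8 + b) is
  (b, 8 + a).  The diagonal i_a + eps i_S is annihilated by exactly one diagonal
  of each of its four neighbours (c, U), which is also the one annihilated by
  i_b - eps i_T; by bilinearity this gives the 4-space, and it is the only
  choice.

  Exchanging the ends of a strut reverses eps, so every configuration arises
  from a single Assessor with eps = +1.  The Assessor is recovered from its
  4-space because no other i_c + i_U annihilates it.  Hence there are as many
  configurations in a box-kite as Assessors, and as many 4-spaces as Assessors
  altogether, namely 42.
*)
From mathcomp Require Import all_boot all_order all_algebra.
From mathcomp Require Import boolp classical_sets functions cardinality reals.
From mathcomp Require Import lra.
Require Import Defs.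

Set Implicit Arguments.
Unset Strict Implicit.
Unset Printing Implicit Defensive.

Import GRing.Theory Num.Theory.

(** * The multiplication table of the basis units *)

Local Open Scope nat_scope.

(** The pair (s, c) encodes i_m i_n = (-1)^s i_c. Distinct nonzero indices below 16 always lie in a
    triplet, so the default 0 of [head] is never taken for them. *)
Definition unit_sign_index (m n : nat) : bool * nat :=
  if m == 0 then (false, n) else if n == 0 then (false, m) else
  if m == n then (true, 0) else
  let c := head 0 [seq c <- iota 0 16 | cyclic_trip m n c || cyclic_trip n m c]
  in (cyclic_trip n m c, c).

(** Evaluated once and for all, so that the exhaustive checks below look products up instead of
    searching the triplets. *)
Definition unit_table : seq (seq (bool * nat)) := Eval vm_compute in
  [seq [seq unit_sign_index m n | n <- iota 0 16] | m <- iota 0 16].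

Definition unit_entry (m n : nat) : bool * nat :=
  nth (false, 0) (nth [::] unit_table m) n.

Definition unit_sign (m n : nat) : bool := (unit_entry m n).1.
Definition unit_index (m n : nat) : nat := (unit_entry m n).2.

Lemma all_nat_lt n (P : pred nat) : all P (iota 0 n) -> forall i, i < n -> P i.
Proof. by move/allP=> allP i lt_i; apply: allP; rewrite mem_iota. Qed.

Lemma unit_entry_spec m n : m < 16 -> n < 16 ->
  [&& unit_index m n < 16,
      (m == 0) ==> (unit_entry m n == (false, n)),
      (n == 0) ==> (unit_entry m n == (false, m)) &
      ((m != 0) && (m == n)) ==> (unit_entry m n == (true, 0))].
Proof.
move=> lt_m lt_n; move: n lt_n; apply: all_nat_lt; move: m lt_m.
by apply: all_nat_lt; vm_compute.
Qed.

Lemma cyclic_tripE m n c : m < 16 -> n < 16 -> c < 16 ->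
  [&& m != 0, n != 0 & m != n] ->
  (cyclic_trip m n c = (unit_entry m n == (false, c))) *
  (cyclic_trip n m c = (unit_entry m n == (true, c))).
Proof.
move=> lt_m lt_n lt_c ne_mn; suff /implyP/(_ ne_mn)/andP[/eqP ? /eqP ?] :
  [&& m != 0, n != 0 & m != n] ==>
  (cyclic_trip m n c == (unit_entry m n == (false, c))) &&
  (cyclic_trip n m c == (unit_entry m n == (true, c))) by [].
move: c lt_c {ne_mn}; apply: all_nat_lt; move: n lt_n; apply: all_nat_lt.
by move: m lt_m; apply: all_nat_lt; vm_compute.
Qed.

Lemma unit_index_lt m n : m < 16 -> n < 16 -> unit_index m n < 16.
Proof. by move=> lt_m lt_n; case/andP: (unit_entry_spec lt_m lt_n). Qed.

(** The index of i_m i_n is m xor n, so the indices form a Latin square. *)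
Lemma unit_index_inj m n n' : m < 16 -> n < 16 -> n' < 16 ->
  ((unit_index m n == unit_index m n') = (n == n')) *
  ((unit_index n m == unit_index n' m) = (n == n')).
Proof.
move=> lt_m lt_n lt_n'; suff /andP[/eqP ? /eqP ?] :
  ((unit_index m n == unit_index m n') == (n == n')) &&
  ((unit_index n m == unit_index n' m) == (n == n')) by [].
move: n' lt_n'; apply: all_nat_lt; move: n lt_n; apply: all_nat_lt.
by move: m lt_m; apply: all_nat_lt; vm_compute.
Qed.

Local Open Scope ring_scope.

(** * Bilinearity and products of basis units *)

Section Bilinearity.
Variable R : realType.
Implicit Types (x y z : 'rV[R]_16) (a : R).

Lemma smulDl x y z : smul (x + y) z = smul x z + smul y z.
Proof.
rewrite /smul -big_split; apply: eq_bigr => m _.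
by rewrite -big_split; apply: eq_bigr => n _; rewrite !mxE mulrDl scalerDl.
Qed.

Lemma smulDr x y z : smul x (y + z) = smul x y + smul x z.
Proof.
rewrite /smul -big_split; apply: eq_bigr => m _.
by rewrite -big_split; apply: eq_bigr => n _; rewrite !mxE mulrDr scalerDl.
Qed.

Lemma smulZl a x y : smul (a *: x) y = a *: smul x y.
Proof.
rewrite /smul scaler_sumr; apply: eq_bigr => m _.
rewrite scaler_sumr; apply: eq_bigr => n _.
by rewrite !mxE scalerA mulrA.
Qed.

Lemma smulZr a x y : smul x (a *: y) = a *: smul x y.
Proof.
rewrite /smul scaler_sumr; apply: eq_bigr => m _.
rewrite scaler_sumr; apply: eq_bigr => n _.
by rewrite !mxE scalerA mulrCA.
Qed.

Lemma smul0x x : smul 0 x = 0.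
Proof. by rewrite -[X in smul X _](scale0r 0) smulZl scale0r. Qed.

Lemma smulx0 x : smul x 0 = 0.
Proof. by rewrite -[X in smul _ X](scale0r 0) smulZr scale0r. Qed.

Lemma smul_iunit m n : smul (iunit R m) (iunit R n) = iunit_mul R m n.
Proof.
rewrite /smul (bigD1 m) //= [X in _ + X]big1 => [|i ne_im].
  rewrite addr0 (bigD1 n) //= [X in _ + X]big1 => [|j ne_jn].
    by rewrite addr0 !mxE !eqxx mulr1 scale1r.
  by rewrite !mxE (negPf ne_jn) andbF mulr0 scale0r.
by apply: big1 => j _; rewrite !mxE (negPf ne_im) andbF mul0r scale0r.
Qed.

Lemma iunit_mulE (m n k : 'I_16) :
  iunit_mul R m n 0 k = (-1) ^+ unit_sign m n * (unit_index m n == k)%:R.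
Proof.
have /and4P[_] := unit_entry_spec (ltn_ord m) (ltn_ord n).
rewrite /iunit_mul /unit_sign /unit_index -!(inj_eq val_inj) /=.
case: eqVneq => [_ /eqP-> _ _ | m0 _]; first by rewrite /= !mxE mul1r eq_sym.
case: eqVneq => [_ /eqP-> _ | n0 _]; first by rewrite /= !mxE mul1r eq_sym.
case: eqVneq => [_ /eqP-> | mn _].
  by rewrite /= !mxE expr1 mulN1r eq_sym.
have ne_mn : [&& val m != 0%N, val n != 0%N & val m != val n] by apply/and3P.
(* Only the summand c = k reaches coordinate k; its coefficient is then read off the table. *)
rewrite summxE (bigD1 k) //= big1 => [|c ne_ck]; last first.
  by rewrite !mxE (eq_sym k) (negPf ne_ck) mulr0.
rewrite !(cyclic_tripE (ltn_ord m) (ltn_ord n) (ltn_ord k) ne_mn).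
rewrite !mxE !eqxx addr0 mulr1; case: (unit_entry m n) => -[] c.
  by rewrite !xpair_eqE /= sub0r mulN1r.
by rewrite !xpair_eqE /= subr0 mul1r.
Qed.

End Bilinearity.

(** * Vanishing products of two diagonals *)

Definition code (p : index_pair) : nat * nat := (val p.1, val p.2).

(* Within the four terms of (i_a + s i_b)(i_c + t i_d) only i_a i_c can cancel
   against i_b i_d and i_a i_d against i_b i_c. *)
Definition zdiv (s : bool) (c : nat * nat) (t : bool) (d : nat * nat) : bool :=
  [&& unit_index c.1 d.1 == unit_index c.2 d.2,
      unit_index c.1 d.2 == unit_index c.2 d.1,
      unit_sign c.1 d.1 != s (+) t (+) unit_sign c.2 d.2 &
      t (+) unit_sign c.1 d.2 != s (+) unit_sign c.2 d.1].

Lemma smul_diagonalE (R : realType) s p t q k :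
  smul (diagonal R s p) (diagonal R t q) 0 k =
    (-1) ^+ unit_sign p.1 q.1 * (unit_index p.1 q.1 == k)%:R +
    (-1) ^+ (t (+) unit_sign p.1 q.2) * (unit_index p.1 q.2 == k)%:R +
    ((-1) ^+ (s (+) unit_sign p.2 q.1) * (unit_index p.2 q.1 == k)%:R +
     (-1) ^+ (s (+) t (+) unit_sign p.2 q.2) * (unit_index p.2 q.2 == k)%:R).
Proof.
rewrite /diagonal smulDl !smulDr !smulZl !smulZr !smul_iunit !signr_addb.
by rewrite -!mulrA -!iunit_mulE !mxE.
Qed.

(** Here [e] says whether two signed terms share a basis unit: they cancel only if they do and their
    signs differ. *)
Lemma signr_add_eq0 (R : realType) (b c e : bool) :
  ((-1) ^+ b + (-1) ^+ c * e%:R == 0 :> R) = e && (b != c).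
Proof.
by case: b c e => [] [] []; rewrite ?expr0 ?expr1 ?mulr1 ?mulr0 ?addr0 /=;
  apply/eqP; lra.
Qed.

Lemma smul_diagonal_eq0 (R : realType) s p t q : wf_pair p -> wf_pair q ->
  (smul (diagonal R s p) (diagonal R t q) == 0) = zdiv s (code p) t (code q).
Proof.
case: p q => a b [c d] /andP[/= _ lt_ab] /andP[/= _ lt_cd].
have lt16 (i : 'I_16) : (i < 16)%N by [].
pose inj m n n' := unit_index_inj (lt16 m) (lt16 n) (lt16 n').
rewrite /zdiv /=; apply/eqP/and4P => [prod0 | [/eqP e1 /eqP e2 s1 s2]].
  pose coef0 k (ltk : (k < 16)%N) :=
    etrans (esym (smul_diagonalE R s (a, b) t (c, d) (Ordinal ltk)))
           (congr1 (fun v : 'rV[R]_16 => v 0 (Ordinal ltk)) prod0).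
  (* The coordinates at i_a i_c and i_a i_d suffice: as a, b and c, d are distinct, the Latin square
     kills two of the four terms in each, leaving a sign and one possible partner. *)
  have := coef0 _ (unit_index_lt (lt16 a) (lt16 c)).
  have := coef0 _ (unit_index_lt (lt16 a) (lt16 d)).
  rewrite /= !mxE !eqxx !inj (ltn_eqF lt_cd) (gtn_eqF lt_cd) (gtn_eqF lt_ab).
  rewrite !mulr0 !add0r !addr0 !mulr1 (eq_sym (unit_index b c)).
  rewrite (eq_sym (unit_index b d)).
  by move=> /eqP; rewrite signr_add_eq0 => /andP[? ?] /eqP;
    rewrite signr_add_eq0 => /andP[].
have sum0 (u v : bool) : u != v -> (-1) ^+ u + (-1) ^+ v = 0 :> R.
  move=> ne_uv; have := signr_add_eq0 R u v true.
  by rewrite mulr1 ne_uv => /eqP.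
apply/rowP => k; rewrite smul_diagonalE /= mxE e1 e2 [X in _ + X]addrC addrACA.
by rewrite -!mulrDl !sum0 // !mul0r addr0.
Qed.

(** * The Co-Assessor relation as a finite table *)

Local Open Scope nat_scope.

(** All index pairs as plain naturals, on which [vm_compute] can run without unfolding ordinals or
    finite sets. *)
Definition codes : seq (nat * nat) :=
  [seq (a, b) | a <- iota 0 16, b <- iota 0 16].

Definition acode (c : nat * nat) : bool :=
  [&& 0 < c.1 < 8, 8 < c.2 < 16 & c.2 != c.1 + 8].

(* The Assessors (a, S) of one box-kite are those with the same index of
   i_a i_S up to sign; this index runs over 9, ..., 15. *)
Definition kite_index (c : nat * nat) : nat := unit_index c.1 c.2.

Definition opp_code (c : nat * nat) : nat * nat := (c.2 - 8, c.1 + 8).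

Definition adjacent (c d : nat * nat) : bool :=
  [&& acode c, acode d, kite_index c == kite_index d, d != c &
      d != opp_code c].

(** For adjacent codes exactly one sign gives a zero product, so testing the sign + ([false])
    determines it. *)
Definition matching_sign (s : bool) (c d : nat * nat) : bool :=
  ~~ zdiv s c false d.

Lemma mem_codes a b : ((a, b) \in codes) = (a < 16) && (b < 16).
Proof.
apply/allpairsP/andP => [[[x y] [+ + [-> ->]]] | [lt_a lt_b]].
  by rewrite !mem_iota.
by exists (a, b); split; rewrite ?mem_iota.
Qed.

Lemma codes_uniq : uniq codes.
Proof. by vm_compute. Qed.

Lemma code_in p : code p \in codes.
Proof. by rewrite mem_codes !ltn_ord. Qed.

Lemma code_inj : injective code.
Proof. by case=> a b [c d] [/val_inj-> /val_inj->]. Qed.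

Lemma code_onto c : c \in codes -> exists p, code p = c.
Proof.
case: c => a b; rewrite mem_codes => /andP[lt_a lt_b].
by exists (Ordinal lt_a, Ordinal lt_b).
Qed.

Lemma has_codes (P : pred (nat * nat)) : has P codes -> exists p, P (code p).
Proof. by case/hasP=> c /code_onto[p <-] Pp; exists p. Qed.

Lemma card_code_set (P : pred (nat * nat)) :
  #|[set p | P (code p)]%SET| = count P codes.
Proof.
rewrite cardE -(size_map code) -size_filter.
apply/perm_size/uniq_perm; rewrite ?map_inj_uniq ?enum_uniq ?filter_uniq //;
  do ?exact: code_inj; do ?exact: codes_uniq.
move=> c; rewrite mem_filter; apply/mapP/andP => [[p + ->] | [Pc]].
  by rewrite mem_enum inE code_in.
by case/code_onto=> p def_c; exists p; rewrite // mem_enum inE def_c.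
Qed.

Lemma acode_wf c : acode c -> 0 < c.1 < c.2.
Proof.
case/and3P=> /andP[-> lt8] /andP[gt8 _] _.
exact: leq_ltn_trans (ltnW lt8) gt8.
Qed.

(** Decided by evaluating all 256 * 256 pairs of codes; the signs range over an explicit list so
    that the test computes. *)
Lemma coassessor_codes c d : c \in codes -> d \in codes ->
  [&& 0 < c.1 < c.2, 0 < d.1 < d.2 &
      has (fun s => has (fun t => zdiv s c t d) [:: false; true])
          [:: false; true]] = adjacent c d.
Proof.
move=> c_in d_in; apply/eqP; move: d d_in; apply/allP; move: c c_in.
by apply/allP; vm_compute.
Qed.

Lemma coassessorsE (R : realType) p q :
  coassessors R p q = adjacent (code p) (code q).
Proof.
rewrite -coassessor_codes ?code_in //; rewrite /coassessors.
apply: andb_id2l => wf_p; apply: andb_id2l => wf_q.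
apply/existsP/hasP => [[s /existsP[t]] | [s _ /hasP[t _]]].
  rewrite smul_diagonal_eq0 // => zst; exists s; first by case: s {zst}.
  by apply/hasP; exists t; first by case: t {zst}.
rewrite -(smul_diagonal_eq0 R) // => zst.
by exists s; apply/existsP; exists t.
Qed.

(** * Opposite Assessors *)

Definition opp (p : index_pair) : index_pair :=
  (inord (p.2 - 8), inord (p.1 + 8)).

Definition kite (n : nat) : {set index_pair} :=
  [set p | acode (code p) && (kite_index (code p) == n)]%SET.

Lemma code_opp p : acode (code p) -> code (opp p) = opp_code (code p).
Proof.
case: p => a b /and3P[/andP[/= a0 a8] /andP[/= b8 b16] _].
rewrite /code /opp /opp_code /= !inordK //.
  by rewrite -[16]/(8 + 8) ltn_add2r.
exact: leq_ltn_trans (leq_subr _ _) b16.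
Qed.

Lemma opp_code_spec c : c \in codes -> acode c ->
  [/\ acode (opp_code c), kite_index (opp_code c) = kite_index c,
      opp_code c != c, opp_code (opp_code c) = c &
      8 < kite_index c < 16].
Proof.
move=> c_in ac; suff: acode c ==>
  [&& acode (opp_code c), kite_index (opp_code c) == kite_index c,
      opp_code c != c, opp_code (opp_code c) == c & 8 < kite_index c < 16].
  by rewrite ac => /and5P[? /eqP ? ? /eqP ? ?].
by move: c c_in {ac}; apply/allP; vm_compute.
Qed.

Lemma opp_spec p : acode (code p) ->
  [/\ acode (code (opp p)), kite_index (code (opp p)) = kite_index (code p),
      opp p != p & opp (opp p) = p].
Proof.
move=> ap; have [ao ko no oo _] := opp_code_spec (code_in p) ap.
have co := code_opp ap; split; rewrite ?co //.
  by rewrite -(inj_eq code_inj) co.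
by apply: code_inj; rewrite code_opp ?co.
Qed.

Lemma adjacentE p q : adjacent (code p) (code q) =
  [&& acode (code p), acode (code q),
      kite_index (code p) == kite_index (code q), q != p & q != opp p].
Proof.
rewrite /adjacent (inj_eq code_inj); case ap: (acode _) => //=.
by rewrite -code_opp // (inj_eq code_inj).
Qed.

(** Opposite vertices are not adjacent, so connecting them takes a path through a common
    neighbour. *)
Lemma adjacent_opp_via p : acode (code p) ->
  exists q, adjacent (code p) (code q) && adjacent (code q) (code (opp p)).
Proof.
move=> ap; rewrite code_opp //.
apply: (@has_codes (fun c => adjacent _ c && adjacent c _)).
move: ap; apply/implyP; move: (code p) (code_in p).
by apply/allP; vm_compute.
Qed.

(** * Box-kites, their octahedra and their struts *)

Section BoxKites.
Variable R : realType.
Implicit Types (p q r : index_pair) (K : {set index_pair}).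

Lemma assessorsE p : (p \in assessors R) = acode (code p).
Proof.
rewrite inE; apply/existsP/idP => [[q] | /adjacent_opp_via[q /andP[pq _]]].
  by rewrite coassessorsE => /andP[].
by exists q; rewrite coassessorsE.
Qed.

(** The kite index is constant along edges; conversely, vertices with equal index are equal,
    adjacent, or opposite and joined in two steps. *)
Lemma kite_connect p q : acode (code p) ->
  connect (coassessors R) p q = (q \in kite (kite_index (code p))).
Proof.
move=> ap; rewrite inE; apply/idP/andP => [|[aq /eqP eq_k]].
  case/connectP=> s; elim: s p ap => [|x s IHs] p ap /=; first by move=> _ ->.
  rewrite coassessorsE => /andP[/and5P[_ ax /eqP-> _ _] path_s def_q].
  exact: IHs path_s def_q.
have adjC x y : adjacent (code x) (code y) -> connect (coassessors R) x y.
  by move=> xy; apply: connect1; rewrite coassessorsE.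
have [-> | ne_qp] := eqVneq q p; first exact: connect0.
have [-> | ne_qo] := eqVneq q (opp p); last first.
  by apply: adjC; rewrite adjacentE ap aq eq_k eqxx ne_qp.
have [x /andP[px xq]] := adjacent_opp_via ap.
exact: connect_trans (adjC _ _ px) (adjC _ _ xq).
Qed.

Lemma boxkiteP K : reflect
  (exists2 p, acode (code p) & K = kite (kite_index (code p)))
  (K \in boxkites R).
Proof.
have kiteE p : acode (code p) ->
    [set q in assessors R | connect (coassessors R) p q]%SET =
    kite (kite_index (code p)).
  move=> ap; apply/setP => q; rewrite inE assessorsE kite_connect // inE.
  by rewrite andbA andbb.
apply: (iffP imsetP) => [[p] | [p ap ->]].
  by rewrite assessorsE => ap ->; exists p; rewrite ?kiteE.
by exists p; rewrite ?assessorsE ?kiteE.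
Qed.

Lemma kite_nonempty n : 8 < n < 16 -> exists p, p \in kite n.
Proof.
move=> lt_n.
have [p Pp] : exists p, acode (code p) && (kite_index (code p) == n).
  apply: (@has_codes (fun c => acode c && (kite_index c == n))).
  case/andP: lt_n => gt8 lt16; move: gt8; apply/implyP; move: n lt16.
  by apply: all_nat_lt; vm_compute.
by exists p; rewrite inE.
Qed.

Lemma card_boxkites : #|boxkites R| = 7.
Proof.
(* Kite indices run over 9, ..., 15, hence the shift by 9; nonemptiness makes the seven kites
   distinct. *)
pose kiteI (i : 'I_7) := kite (9 + i).
have bd (i : 'I_7) : 8 < 9 + i < 16.
  by rewrite leq_addr /= -[16]/(9 + 7) ltn_add2l.
have inj_k : injective kiteI.
  move=> i j eq_ij; have [p p_i] := kite_nonempty (bd i).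
  have: p \in kite (9 + j) by rewrite -/(kiteI j) -eq_ij.
  move: p_i; rewrite !inE => /andP[_ /eqP->] /andP[_].
  by rewrite eqn_add2l => /eqP/val_inj.
suff -> : boxkites R = kiteI @: [set: 'I_7]%SET.
  by rewrite card_imset // cardsT card_ord.
apply/setP => K; apply/boxkiteP/imsetP => [[p ap ->] | [i _ ->]].
  have [_ _ _ _ /andP[gt8 lt16]] := opp_code_spec (code_in p) ap.
  have lt7 : kite_index (code p) - 9 < 7 by rewrite ltn_subLR.
  by exists (Ordinal lt7); rewrite // /kiteI /= subnKC.
have [p p_i] := kite_nonempty (bd i); exists p; move: p_i.
  by rewrite inE => /andP[].
by rewrite inE => /andP[_ /eqP->].
Qed.

Lemma card_kite p : acode (code p) -> #|kite (kite_index (code p))| = 6.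
Proof.
move=> ap; rewrite (card_code_set (fun c => acode c && (kite_index c == _))).
apply/eqP; move: ap; apply/implyP; move: (code p) (code_in p).
by apply/allP; vm_compute.
Qed.

Lemma card_assessors : #|assessors R| = 42.
Proof.
transitivity (count acode codes); last by vm_compute.
by rewrite -card_code_set; apply: eq_card => p; rewrite assessorsE inE.
Qed.

Lemma is_strutE n p q :
  is_strut R (kite n) p q = (p \in kite n) && (q == opp p).
Proof.
rewrite /is_strut; case p_n: (p \in kite n) => //=.
move: p_n; rewrite !inE => /andP[ap /eqP kp]; rewrite coassessorsE adjacentE.
have [ao ko no _] := opp_spec ap; rewrite ap kp /=.
have [-> | _] := eqVneq q (opp p).
  by rewrite ao ko kp eqxx eq_sym no andbF.
rewrite [p == q]eq_sym; case: (acode _); case: eqVneq => //=.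
by rewrite ?eqxx; case: eqVneq.
Qed.

Lemma kite_octahedron p : acode (code p) ->
  octahedron (coassessors R) (kite (kite_index (code p))).
Proof.
move=> ap; rewrite /octahedron card_kite //=; apply/forall_inP => q q_in.
apply/eqP; transitivity #|[set opp q]%SET|; last exact: cards1.
apply: eq_card => r.
have := is_strutE (kite_index (code p)) q r.
by rewrite /is_strut q_in !inE /= => <-; rewrite [q == r]eq_sym.
Qed.

Lemma card_struts p : acode (code p) ->
  #|struts R (kite (kite_index (code p)))| = 3.
Proof.
move=> ap; set n := kite_index _.
(* A strut joins (a, 8 + b) and (b, 8 + a); [half] keeps the end with a < b, one for each strut. *)
pose half := [set q | [&& acode (code q), kite_index (code q) == n &
                          (code q).1 + 8 < (code q).2]]%SET.
have card_half : #|half| = 3.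
  rewrite (card_code_set
    (fun c => [&& acode c, kite_index c == n & c.1 + 8 < c.2])).
  apply/eqP; rewrite /n; move: ap; apply/implyP; move: (code p) (code_in p).
  by apply/allP; vm_compute.
pose strut q := [set q; opp q]%SET.
have half_opp q : q \in half -> opp q \notin half.
  rewrite inE => /and3P[aq _ lt_q]; apply/negP; rewrite inE => /and3P[_ _].
  rewrite code_opp //=; case/and3P: aq => _ /andP[gt8 _] _.
  by rewrite subnK ?(ltnW gt8) // ltnNge ltnW.
suff -> : struts R (kite n) = strut @: half.
  rewrite card_in_imset // => q r q_h r_h eq_qr.
  have: q \in strut r by rewrite -eq_qr !inE eqxx.
  rewrite !inE => /orP[/eqP // | /eqP def_q].
  by have := half_opp r r_h; rewrite -def_q q_h.
apply/setP => S; apply/imsetP/imsetP => [[[q r]] | [q q_h ->]]; last first.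
  exists (q, opp q); rewrite // inE is_strutE eqxx andbT.
  by move: q_h; rewrite !inE => /and3P[-> ->].
rewrite inE is_strutE => /andP[+ /eqP /= ->] ->; rewrite inE => /andP[aq kq].
have [ao ko _ oo] := opp_spec aq.
have [lt_q | ge_q] := ltnP ((code q).1 + 8) (code q).2.
  by exists q; rewrite // inE aq kq.
exists (opp q); last by rewrite /strut oo finset.setUC.
rewrite inE ao ko kq code_opp //=.
case/and3P: aq => _ /andP[gt8 _] ne_q; rewrite subnK ?(ltnW gt8) //.
by rewrite ltn_neqAle ne_q.
Qed.

End BoxKites.

(** * Matching signs of neighbouring Assessors *)

(* Call-by-value evaluation also runs through the second argument of [&&] and
   [==>], hence the filtered lists. *)
Definition acodes : seq (nat * nat) := filter acode codes.

Definition neighbours (c : nat * nat) : seq (nat * nat) :=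
  filter (adjacent c) acodes.

Lemma mem_acodes c : c \in codes -> acode c -> c \in acodes.
Proof. by rewrite mem_filter => -> ->. Qed.

Lemma mem_neighbours c d : d \in codes -> adjacent c d -> d \in neighbours c.
Proof.
move=> d_in cd; have /and3P[_ ad _] := cd.
by rewrite mem_filter cd mem_acodes.
Qed.

(** The source of the planes: a diagonal and the opposite-sign diagonal across the strut select the
    same diagonal of each neighbour, in either order of the factors. *)
Lemma matching_sign_spec c d s t : c \in codes -> d \in codes ->
  adjacent c d ->
  [/\ zdiv s c t d = (t == matching_sign s c d),
      zdiv t d s c = (t == matching_sign s c d),
      zdiv (~~ s) (opp_code c) t d = (t == matching_sign s c d) &
      zdiv t d (~~ s) (opp_code c) = (t == matching_sign s c d)].
Proof.
move=> c_in d_in cd; have [ac _] := andP cd.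
suff /and4P[/eqP ? /eqP ? /eqP ? /eqP ?] :
  [&& zdiv s c t d == (t == matching_sign s c d),
      zdiv t d s c == (t == matching_sign s c d),
      zdiv (~~ s) (opp_code c) t d == (t == matching_sign s c d) &
      zdiv t d (~~ s) (opp_code c) == (t == matching_sign s c d)] by [].
have {d_in cd} d_n := mem_neighbours d_in cd; move: d d_n; apply/allP.
have {c_in ac} c_a := mem_acodes c_in ac; move: c c_a; apply/allP.
by case: s t => [] []; vm_compute.
Qed.

(** If c' differs from c, a finite search finds a neighbour of c whose matching diagonal is not
    annihilated by the plus diagonal of c'. *)
Lemma matching_sign_inj c c' : c \in codes -> c' \in codes ->
  acode c -> acode c' ->
  (forall d, d \in codes -> adjacent c d ->
     zdiv false c' (matching_sign false c d) d) -> c = c'.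
Proof.
move=> c_in c'_in ac ac' sub; apply/eqP; apply: contraT => ne_cc'.
have: has (fun d => ~~ zdiv false c' (matching_sign false c d) d)
          (neighbours c).
  move: ne_cc' {sub}; apply/implyP.
  have {c'_in ac'} c'_a := mem_acodes c'_in ac'; move: c' c'_a; apply/allP.
  have {c_in ac} c_a := mem_acodes c_in ac; move: c c_a; apply/allP.
  by vm_compute.
case/hasP=> d; rewrite !mem_filter => /and3P[cd _ d_in] /negP[].
exact: sub.
Qed.

(** * Spans of diagonals: dimensions and zero products *)

Local Open Scope ring_scope.

Lemma span_ind (K : fieldType) (vT : vectType K) (P : vT -> Prop) (X : seq vT) :
  P 0 -> (forall a u v, P u -> P v -> P (a *: u + v)) ->
  (forall x, x \in X -> P x) -> forall v, v \in <<X>>%VS -> P v.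
Proof.
move=> P0 PD PX v; rewrite -[X]in_tupleE => /coord_span->.
elim/big_rec: _ => // i u _ Pu; apply: PD => //.
by apply: PX; rewrite mem_nth.
Qed.

Lemma neighbours_kite p : acode (code p) ->
  (kite (kite_index (code p)) :\: [set p; opp p])%SET =
  [set r | adjacent (code p) (code r)]%SET.
Proof.
move=> ap; apply/setP => r; rewrite !inE adjacentE ap negb_or /=.
rewrite [kite_index (code r) == _]eq_sym.
by rewrite andbC -!andbA.
Qed.

(** By the Latin square, a and the index of i_a i_S determine S; hence first indices are distinct
    within a kite, as [free_diagonals] requires. *)
Lemma kite_index_inj p q : p.1 = q.1 ->
  kite_index (code p) = kite_index (code q) -> p = q.
Proof.
case: p q => a b [c d] /= ->; rewrite /kite_index /= => /eqP.
by rewrite unit_index_inj ?ltn_ord // => /eqP/val_inj->.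
Qed.

Section StrutSpaces.
Variable R : realType.
Implicit Types (p q r : index_pair) (sg : index_pair -> bool).

Lemma diagonalE s p k : diagonal R s p 0 k =
  (p.1 == k)%:R + (-1) ^+ s * (p.2 == k)%:R.
Proof. by rewrite !mxE eqxx /= ![k == _]eq_sym. Qed.

(** Coordinate [p.1] separates the diagonal of [p] from the others: first indices are distinct and
    below 8, second ones above 8. *)
Lemma free_diagonals sg (s : seq index_pair) :
  uniq [seq r.1 | r <- s] -> {in s, forall r, acode (code r)} ->
  free [seq diagonal R (sg r) r | r <- s].
Proof.
elim: s => [|p s IHs] /=; first by rewrite nil_free.
case/andP=> p_s uniq_s as_; rewrite free_cons IHs // => [|r r_s]; last first.
  by apply: as_; rewrite inE r_s orbT.
rewrite andbT; apply/negP => p_span.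
have ne_sec r : r \in p :: s -> (r.2 == p.1) = false.
  move=> r_ps; have /and3P[/andP[_ p8] _ _] := as_ p (mem_head _ _).
  have /and3P[_ /andP[r8 _] _] := as_ r r_ps.
  by apply/negbTE; rewrite -(inj_eq val_inj) gtn_eqF // (ltn_trans p8 r8).
have: diagonal R (sg p) p 0 p.1 = 0.
  apply: (span_ind (P := fun v : 'rV[R]_16 => v 0 p.1 = 0)) p_span.
  - by rewrite mxE.
  - by move=> a u v u0 v0; rewrite !mxE u0 v0 mulr0 addr0.
  move=> _ /mapP[r r_s ->]; rewrite diagonalE ne_sec ?inE ?r_s ?orbT //.
  rewrite mulr0 addr0; case: eqP => // def_p.
  by move: p_s; rewrite -def_p map_f.
rewrite diagonalE eqxx ne_sec ?mem_head // mulr0 addr0.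
by move/eqP; rewrite oner_eq0.
Qed.

Lemma dim_strut_plane p eps : acode (code p) ->
  \dim (strut_plane R p (opp p) eps) = 2%N.
Proof.
move=> ap; have [ao ko no _] := opp_spec ap.
(* These signs present the plane as a family of diagonals to which [free_diagonals] applies. *)
pose sg r := if r == p then eps else ~~ eps.
have -> : strut_plane R p (opp p) eps =
    <<[seq diagonal R (sg r) r | r <- [:: p; opp p]]>>%VS.
  by rewrite /strut_plane /= /sg eqxx (negPf no).
apply/eqP; rewrite -/(free _) free_diagonals //; last first.
  by move=> r; rewrite !inE => /orP[] /eqP->.
rewrite /= inE andbT; apply: contraNneq no => e1.
by apply/eqP/esym/kite_index_inj; rewrite ?ko.
Qed.

Lemma dim_diagonal_space p sg : acode (code p) ->
  \dim (diagonal_space R (kite (kite_index (code p))) p (opp p) sg) = 4%N.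
Proof.
move=> ap; rewrite /diagonal_space neighbours_kite //.
transitivity #|[set r | adjacent (code p) (code r)]%SET|; last first.
  rewrite (card_code_set (adjacent (code p))).
  apply/eqP; move: ap; apply/implyP; move: (code p) (code_in p).
  by apply/allP; vm_compute.
rewrite cardE -(size_map (fun r => diagonal R (sg r) r)); apply/eqP.
rewrite -/(free _) free_diagonals // => [|r]; last first.
  by rewrite mem_enum inE => /and3P[].
rewrite map_inj_in_uniq ?enum_uniq // => q r.
rewrite !mem_enum !inE => /and4P[_ _ /eqP kq _] /and4P[_ _ /eqP kr _] e1.
by apply: kite_index_inj; rewrite // -kq.
Qed.

Lemma strut_planeC p q eps :
  strut_plane R p q eps = strut_plane R q p (~~ eps).
Proof. by rewrite /strut_plane !span_cons span_nil !addv0 addvC negbK. Qed.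

Lemma diagonal_spaceC (K : {set index_pair}) p q sg :
  diagonal_space R K p q sg = diagonal_space R K q p sg.
Proof. by rewrite /diagonal_space finset.setUC. Qed.

Lemma zero_product_span (X Y : seq 'rV[R]_16) :
  (forall x y, x \in X -> y \in Y -> smul x y = 0 /\ smul y x = 0) ->
  zero_product <<X>>%VS <<Y>>%VS.
Proof.
move=> XY0 x y xX yY.
apply: (span_ind (P := fun x => smul x y = 0 /\ smul y x = 0)) xX.
- by rewrite smul0x smulx0.
- move=> a u v [u1 u2] [v1 v2].
  by rewrite smulDl smulDr smulZl smulZr u1 u2 v1 v2 scaler0 addr0.
move=> {}x xX.
apply: (span_ind (P := fun y => smul x y = 0 /\ smul y x = 0)) yY.
- by rewrite smul0x smulx0.
- move=> a u v [u1 u2] [v1 v2].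
  by rewrite smulDl smulDr smulZl smulZr u1 u2 v1 v2 scaler0 addr0.
by move=> {}y; apply: XY0.
Qed.

(** The diagonal at [p] alone forces every sign; [matching_sign_spec] then gives the remaining
    products of generators, and bilinearity those of the spans. *)
Lemma zero_productP p eps sg : acode (code p) ->
  zero_product (strut_plane R p (opp p) eps)
    (diagonal_space R (kite (kite_index (code p))) p (opp p) sg) <->
  (forall r, adjacent (code p) (code r) ->
     sg r = matching_sign eps (code p) (code r)).
Proof.
move=> ap; rewrite /diagonal_space neighbours_kite //.
have [/acode_wf wf_o _ _ _] := opp_spec ap; have wf_p := acode_wf ap.
have wf_r r : adjacent (code p) (code r) -> wf_pair r.
  by case/and3P=> _ /acode_wf.
split=> [zero r pr | match_sg].
  have [smul0 _] : smul (diagonal R eps p) (diagonal R (sg r) r) = 0 /\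
                   smul (diagonal R (sg r) r) (diagonal R eps p) = 0.
    apply: zero; apply: memv_span; first exact: mem_head.
    by apply: map_f; rewrite mem_enum inE.
  move/eqP: smul0; rewrite smul_diagonal_eq0 ?(wf_r r) //.
  by have [-> _ _ _] := matching_sign_spec eps (sg r) (code_in p) (code_in r) pr
    => /eqP.
apply: zero_product_span => x y; rewrite !inE => p_x /mapP[r].
rewrite mem_enum inE => pr ->; have := match_sg r pr => /eqP sg_r.
have [z1 z2 z3 z4] := matching_sign_spec eps (sg r) (code_in p) (code_in r) pr.
rewrite -code_opp // in z3 z4.
by case/orP: p_x => /eqP->; split; apply/eqP;
  rewrite smul_diagonal_eq0 ?(wf_r r) // ?z1 ?z2 ?z3 ?z4.
Qed.

(** * Counting configurations by Assessors *)

Definition assessor_plane p := strut_plane R p (opp p) false.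

Definition assessor_space p := diagonal_space R (kite (kite_index (code p)))
  p (opp p) (fun r => matching_sign false (code p) (code r)).

(** The plus diagonal of [q] annihilates its own space, hence every matching diagonal around [p],
    which only [p] can do. *)
Lemma assessor_space_inj p q : acode (code p) -> acode (code q) ->
  assessor_space p = assessor_space q -> p = q.
Proof.
move=> ap aq eq_pq; apply: code_inj.
apply: matching_sign_inj; rewrite ?code_in // => c /code_onto[r <-] pr.
have [zero _] : smul (diagonal R false q)
    (diagonal R (matching_sign false (code p) (code r)) r) = 0 /\
  smul (diagonal R (matching_sign false (code p) (code r)) r)
    (diagonal R false q) = 0.
  have [_ zero] := zero_productP false
    (fun r => matching_sign false (code q) (code r)) aq.
  apply: (zero (fun _ _ => erefl)); first by apply: memv_span; apply: mem_head.
  rewrite -/(assessor_space q) -eq_pq /assessor_space /diagonal_space.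
  rewrite neighbours_kite //; apply: memv_span.
  by apply/mapP; exists r; rewrite // mem_enum inE.
have [_ ar _] := and3P pr.
have wf_q : wf_pair q := acode_wf aq; have wf_r : wf_pair r := acode_wf ar.
by rewrite -(smul_diagonal_eq0 R) // zero.
Qed.

Lemma configuration_assessor p eps sg : acode (code p) ->
  zero_product (strut_plane R p (opp p) eps)
    (diagonal_space R (kite (kite_index (code p))) p (opp p) sg) ->
  exists q, [/\ acode (code q), kite_index (code q) = kite_index (code p),
    strut_plane R p (opp p) eps = assessor_plane q &
    diagonal_space R (kite (kite_index (code p))) p (opp p) sg =
    assessor_space q].
Proof.
(* The sign -1 reduces to +1 by exchanging the ends of the strut, which changes neither the plane
   nor the 4-space. *)
wlog -> : p eps / eps = false =>
    [base ap zero | ap /(zero_productP _ _ ap) match_sg].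
  case: eps zero => zero; last exact: base.
  have [ao ko _ oo] := opp_spec ap.
  rewrite strut_planeC diagonal_spaceC in zero *.
  by have := base (opp p) false erefl ao; rewrite oo ko; apply.
exists p; split=> //; rewrite /assessor_space /diagonal_space.
congr <<_>>%VS; apply/eq_in_map => r; rewrite neighbours_kite // mem_enum inE.
by move/match_sg->.
Qed.

(** Carries a finite-set cardinal over to the classical [#=], with [enum_val] parametrising [A] by
    ordinals. *)
Lemma card_eq_image (T : finType) (U : Type) (A : {set T}) (f : T -> U) n :
  #|A| = n -> {in A &, injective f} -> (f @` [set` A] #= `I_n)%card.
Proof.
move=> <- f_inj.
have -> : (f @` [set` A] = (f \o enum_val) @` [set: 'I_#|A|])%classic.
  apply/seteqP; split=> [_ [x /= xA <-] | _ [i _ <-]].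
    by exists (enum_rank_in xA x); rewrite //= enum_rankK_in.
  by exists (enum_val i); first exact: enum_valP.
apply: card_eq_trans (card_esym card_II); apply: inj_card_eq => i j _ _ /=.
by move/f_inj => /(_ (enum_valP i) (enum_valP j))/enum_val_inj.
Qed.

Lemma configurationsE p : acode (code p) ->
  configurations R (kite (kite_index (code p))) =
  ((fun q => (assessor_plane q, assessor_space q)) @`
    [set` kite (kite_index (code p))])%classic.
Proof.
move=> ap; apply/seteqP; split=> PV => [|[q /=]].
  case=> q [r [eps [sg []]]]; rewrite is_strutE inE.
  case/andP=> /andP[aq /eqP kq] /eqP->.
  move=> ->; rewrite -kq => /(configuration_assessor aq)[q' [aq' kq' -> ->]].
  by exists q'; rewrite //= inE aq' kq' /=.
rewrite inE => /andP[aq /eqP kq] <-.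
exists q, (opp q), false, (fun r => matching_sign false (code q) (code r)).
split; first by rewrite is_strutE inE aq kq !eqxx.
  by rewrite -kq.
by apply/zero_productP.
Qed.

Lemma configuration_spacesE :
  configuration_spaces R = (assessor_space @` [set` assessors R])%classic.
Proof.
apply/seteqP; split=> V => [[K [P [/boxkiteP[p ap ->]]]] | [q /= + <-]].
  rewrite configurationsE // => -[q /=].
  by rewrite inE => /andP[aq _] [_ <-]; exists q; rewrite //= assessorsE.
rewrite assessorsE => aq.
exists (kite (kite_index (code q))), (assessor_plane q).
split; first by apply/boxkiteP; exists q.
by rewrite configurationsE //; exists q; rewrite //= inE aq /=.
Qed.

End StrutSpaces.

Local Open Scope card_scope.

Theorem mainTheorem4 (R : realType) :
  [/\ #|boxkites R| = 7%N /\
      (forall K : {set index_pair}, K \in boxkites R ->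
         octahedron (coassessors R) K /\ #|struts R K| = 3%N),
      (forall (K : {set index_pair}) (p q : index_pair) (eps : bool),
         K \in boxkites R -> is_strut R K p q ->
         \dim (strut_plane R p q eps) = 2%N /\
         exists sg : index_pair -> bool,
           \dim (diagonal_space R K p q sg) = 4%N /\
           zero_product (strut_plane R p q eps) (diagonal_space R K p q sg)),
      (forall K : {set index_pair}, K \in boxkites R ->
         configurations R K #= `I_6) &
      configuration_spaces R #= `I_42].
Proof.
split.
- split=> [|K /boxkiteP[p ap ->]]; first exact: card_boxkites.
  by split; [apply: kite_octahedron | apply: card_struts].
- move=> K p q eps /boxkiteP[k ak ->]; rewrite is_strutE inE.
  case/andP=> /andP[ap /eqP <-] /eqP->; split; first exact: dim_strut_plane.
  exists (fun r => matching_sign eps (code p) (code r)).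
  by split; [apply: dim_diagonal_space | apply/zero_productP].
- move=> K /boxkiteP[p ap ->]; rewrite configurationsE //.
  (* The second component suffices for injectivity: the 4-space alone determines the Assessor. *)
  apply: (card_eq_image (card_kite ap)) => q r.
  rewrite !inE => /andP[aq _] /andP[ar _] [_].
  exact: assessor_space_inj.
rewrite configuration_spacesE; apply: (card_eq_image (card_assessors R)) => q r.
rewrite !assessorsE; exact: assessor_space_inj.
Qed.
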